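(* Let $d>1$ and let $\zeta$ be a primitive $d^{\text{th}}$ root of unity. Then $E(\mathfrak S_n,\zeta)\cong \Pi_n^d$ as $\mathfrak S_n$-posets, i.e. there is an $\mathfrak S_n$-equivariant isomorphism of posets between them.
   Context: The symmetric group $\mathfrak S_n$ acts on $V=\mathbb C^n$ by $\sigma(e_i)=e_{\sigma(i)}$. For $g\in\mathfrak S_n$, $V(g,\zeta)=\{v\in V: gv=\zeta v\}$; $E(\mathfrak S_n,\zeta)$ is the poset of all subspaces $V(g,\zeta)$, $g\in\mathfrak S_n$, ordered by reverse inclusion, with action $h\cdot V(g,\zeta)=V(hgh^{-1},\zeta)$. A ($d$-)weighted partition of $\{0,1,\ldots,n\}$ is a set partition $B_0/B_1/\cdots/B_\ell$ of $\{0,1,\ldots,n\}$ with $0\in B_0$ (the zero block), together with a weight in $\mathbb Z/d\mathbb Z$ assigned to each element of $B_1\cup\cdots\cup B_\ell$; elements of $B_0$ are unweighted. For a nonzero block $B$ and $w\in\mathbb Z/d\mathbb Z$, $B^w$ is the block obtained by adding $w$ to the weight of each element of $B$, and $B^{\mathrm{erase}}$ is the block obtained by removing all weights (for the zero block, $B_0^{\mathrm{erase}}=B_0$). Weighted partitions are identified if they differ by replacing nonzero blocks $B$ by shifts $B^w$. The Dowling lattice $\Pi_{n,d}$ is the set of $d$-weighted partitions (up to this identification), with $\pi_1\le\pi_2$ if for each block $B$ of $\pi_1$ there is a block of $\pi_2$ that either contains $B^{\mathrm{erase}}$ or contains $B^w$ for some $w$ (as sets of unweighted, respectively weighted, elements).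 $\mathfrak S_n$ acts on $\Pi_{n,d}$ by $\sigma(B_0/\cdots/B_\ell)=\sigma B_0/\cdots/\sigma B_\ell$ (fixing $0$, elements carrying their weights along). A partition in $\Pi_{n,d}$ is balanced if in each block all weights $w\in\mathbb Z/d\mathbb Z$ appear with equal multiplicity (a vacuous condition for the zero block). $\Pi_n^d$ is the $\mathfrak S_n$-subposet of $\Pi_{n,d}$ consisting of all balanced partitions. *)

(* Defs.v *)
From HB Require Import structures.
From mathcomp Require Import all_boot all_order all_algebra all_fingroup.

Set Implicit Arguments.
Unset Strict Implicit.
Unset Printing Implicit Defensive.

Import Order.TTheory GRing.Theory.
Local Open Scope ring_scope.

(** In this file a left action of the symmetric group is written as a MathComp
    action [to x s]. Permutations compose from left to right in MathComp,
    [(s * t) x = t (s x)], so these are exactly the left actions of the group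
    of permutations under the usual composition, and the usual conjugate
    [h g h^-1] is [(g ^ h)%g = h^-1 * g * h]. *)

Lemma homo_act_mono (gT : finGroupType) disp (T : porderType disp)
    (to : {action gT &-> T}) :
  (forall a x y, (x <= y)%O -> (to x a <= to y a)%O) ->
  forall a, {mono to^~ a : x y / (x <= y)%O}.
Proof.
case: to => f [/= f_inj fM] homo.
have f1 x : f x 1%g = x by apply: (f_inj 1%g); rewrite /= -fM ?inE ?mulg1.
have fK a x : f (f x a) a^-1%g = x by rewrite -fM ?inE ?mulgV.
move=> a x y; apply/idP/idP => [/(homo a^-1%g) | /(homo a) //].
by rewrite !fK.
Qed.

(** * Eigenspaces *)

Definition perm_vect (F : fieldType) n (g : 'S_n) (v : 'cV[F]_n) : 'cV[F]_n :=
  \sum_i v i 0 *: delta_mx (g i) 0.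

Lemma perm_vectE (F : fieldType) n (g : 'S_n) (v : 'cV[F]_n) i :
  perm_vect g v (g i) 0 = v i 0.
Proof.
rewrite /perm_vect summxE (bigD1 i) //= big1 => [|j ji].
  by rewrite !mxE !eqxx mulr1 addr0.
by rewrite !mxE (inj_eq perm_inj) [i == j]eq_sym (negPf ji) mulr0.
Qed.

Fact perm_vect_is_linear (F : fieldType) n (g : 'S_n) :
  linear (@perm_vect F n g).
Proof.
move=> a u v; apply/colP => i.
by rewrite -(permKV g i) perm_vectE !mxE !perm_vectE.
Qed.

HB.instance Definition _ (F : fieldType) n (g : 'S_n) :=
  GRing.isLinear.Build F 'cV[F]_n 'cV[F]_n *:%R (@perm_vect F n g)
    (perm_vect_is_linear g).

Lemma perm_vect_delta (F : fieldType) n (g : 'S_n) i :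
  perm_vect g (delta_mx i 0 : 'cV[F]_n) = delta_mx (g i) 0.
Proof.
apply/colP => j; rewrite -(permKV g j) perm_vectE !mxE.
by rewrite (inj_eq perm_inj).
Qed.

Lemma perm_vect1 (F : fieldType) n (v : 'cV[F]_n) : perm_vect 1%g v = v.
Proof. by apply/colP => i; rewrite -{1}[i](perm1 i) perm_vectE. Qed.

Lemma perm_vectM (F : fieldType) n (g h : 'S_n) (v : 'cV[F]_n) :
  perm_vect (g * h)%g v = perm_vect h (perm_vect g v).
Proof.
apply/colP => i; rewrite -(permKV (g * h)%g i); set j := ((g * h)^-1)%g i.
by rewrite perm_vectE permM !perm_vectE.
Qed.

Definition perm_lfun (F : fieldType) n (g : 'S_n) : 'End('cV[F]_n) :=
  linfun (perm_vect g).

Definition Vspace (F : fieldType) n (zeta : F) (g : 'S_n) : {vspace 'cV[F]_n} :=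
  passmx.leigenspace (perm_lfun F g) zeta.

Lemma memVspace (F : fieldType) n (zeta : F) (g : 'S_n) (v : 'cV[F]_n) :
  (v \in Vspace zeta g) = (perm_vect g v == zeta *: v).
Proof.
by rewrite memv_ker add_lfunE opp_lfunE scale_lfunE id_lfunE lfunE subr_eq0.
Qed.

Lemma VspaceJ (F : fieldType) n (zeta : F) (g h : 'S_n) :
  (perm_lfun F h @: Vspace zeta g)%VS = Vspace zeta (g ^ h)%g.
Proof.
apply/vspaceP => v; apply/memv_imgP/idP.
  case=> u; rewrite memVspace => /eqP gu ->.
  by rewrite memVspace lfunE /= -perm_vectM conjgE mulKVg perm_vectM gu linearZ.
rewrite memVspace => /eqP gv; exists (perm_vect h^-1%g v).
  rewrite memVspace -linearZ -gv /= -!perm_vectM; apply/eqP; congr (perm_vect _ v).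
  by rewrite conjgE -!mulgA mulgV mulg1.
by rewrite lfunE /= -perm_vectM mulVg perm_vect1.
Qed.

Record eigposet (F : fieldType) n (zeta : F) := EigPoset {
  eig_val :> {vspace 'cV[F]_n};
  eig_valP : [exists g : 'S_n, eig_val == Vspace zeta g] }.

HB.instance Definition _ (F : fieldType) n (zeta : F) :=
  [isSub for @eig_val F n zeta].
HB.instance Definition _ (F : fieldType) n (zeta : F) :=
  [Choice of @eigposet F n zeta by <:].

Fact eigposet_display : Order.disp_t. Proof. exact: (Order.Disp tt tt). Qed.

Definition eig_le (F : fieldType) n (zeta : F) (U W : eigposet n zeta) : bool :=
  (eig_val W <= eig_val U)%VS.

Fact eig_le_refl (F : fieldType) n (zeta : F) : reflexive (@eig_le F n zeta).
Proof. by move=> U; exact: subvv. Qed.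

Fact eig_le_anti (F : fieldType) n (zeta : F) : antisymmetric (@eig_le F n zeta).
Proof.
move=> U W /andP[WU UW]; apply/val_inj/eqP.
by rewrite eqEsubv; apply/andP; split.
Qed.

Fact eig_le_trans (F : fieldType) n (zeta : F) : transitive (@eig_le F n zeta).
Proof. by move=> U W X WU UX; exact: subv_trans UX WU. Qed.

HB.instance Definition _ (F : fieldType) n (zeta : F) :=
  Order.Le_isPOrder.Build eigposet_display (@eigposet F n zeta)
    (@eig_le_refl F n zeta) (@eig_le_anti F n zeta) (@eig_le_trans F n zeta).

Fact Vspace_subproof (F : fieldType) n (zeta : F) (g : 'S_n) :
  [exists g', Vspace zeta g == Vspace zeta g'].
Proof. by apply/existsP; exists g. Qed.

Definition eig (F : fieldType) n (zeta : F) (g : 'S_n) : eigposet n zeta :=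
  EigPoset (Vspace_subproof zeta g).

Definition eig_perm (F : fieldType) n (zeta : F) (U : eigposet n zeta) : 'S_n :=
  xchoose (existsP (eig_valP U)).

Lemma eig_permK (F : fieldType) n (zeta : F) :
  cancel (@eig_perm F n zeta) (eig zeta).
Proof.
by move=> U; apply/val_inj/esym/eqP; exact: (xchooseP (existsP (eig_valP U))).
Qed.

(** [h . V(g, zeta) = V(h g h^-1, zeta)]; by [eig_actE] below the result does
    not depend on the chosen [g]. *)
Definition eig_act (F : fieldType) n (zeta : F) (U : eigposet n zeta)
    (h : 'S_n) : eigposet n zeta :=
  eig zeta (eig_perm U ^ h)%g.

Lemma eig_act_val (F : fieldType) n (zeta : F) (U : eigposet n zeta) h :
  eig_val (eig_act U h) = (perm_lfun F h @: U)%VS.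
Proof. by rewrite /eig_act /= -VspaceJ -[in RHS](eig_permK U). Qed.

Lemma eig_actE (F : fieldType) n (zeta : F) (g h : 'S_n) :
  eig_act (eig zeta g) h = eig zeta (g ^ h)%g.
Proof. by apply: val_inj; rewrite [LHS]eig_act_val VspaceJ. Qed.

Fact eig_act1 (F : fieldType) n (zeta : F) (U : eigposet n zeta) :
  eig_act U 1%g = U.
Proof. by rewrite -(eig_permK U) eig_actE conjg1. Qed.

Fact eig_actM (F : fieldType) n (zeta : F) (U : eigposet n zeta) :
  act_morph (@eig_act F n zeta) U.
Proof. by move=> g h; rewrite -(eig_permK U) !eig_actE conjgM. Qed.

Definition eig_action (F : fieldType) n (zeta : F) :
    {action 'S_n &-> eigposet n zeta} :=
  TotalAction (@eig_act1 F n zeta) (@eig_actM F n zeta).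

Lemma eig_action_le (F : fieldType) n (zeta : F) h :
  {mono (eig_action n zeta)^~ h : U W / (U <= W)%O}.
Proof.
apply: homo_act_mono => {}h U W UW.
by rewrite /Order.le /= /eig_le !eig_act_val limgS.
Qed.

(** * Weighted partitions *)

(** An element of a block, together with its weight if it has one. *)
Definition welt n d : finType := ('I_n.+1 * option 'Z_d)%type.

Definition erase n d (D : {set welt n d}) : {set welt n d} :=
  [set (x.1, None) | x in D].

Definition shift n d (w : 'Z_d) (D : {set welt n d}) : {set welt n d} :=
  [set (x.1, omap (+%R^~ w) x.2) | x in D].

Definition is_wpartition n d
    (p : {set {set 'I_n.+1}} * {ffun 'I_n.+1 -> option 'Z_d}) : bool :=
  partition p.1 [set: 'I_n.+1] &&
  [forall x, (p.2 x == None) == (x \in pblock p.1 ord0)].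

(** The set of weights is ['Z_d], that is Z/dZ for [d > 1] only. *)
Record wpartition n d := WPartition {
  wpart_val : {set {set 'I_n.+1}} * {ffun 'I_n.+1 -> option 'Z_d};
  wpart_valP : is_wpartition wpart_val }.

HB.instance Definition _ n d := [isSub for @wpart_val n d].
HB.instance Definition _ n d := [Finite of wpartition n d by <:].

Definition blocks n d (p : wpartition n d) := (wpart_val p).1.
Definition weight n d (p : wpartition n d) := (wpart_val p).2.

(** The block of [p] with underlying set [B], as a set of weighted elements. *)
Definition wblock n d (p : wpartition n d) (B : {set 'I_n.+1}) :
    {set welt n d} :=
  [set (x, weight p x) | x in B].

Definition wequiv n d (p q : wpartition n d) : bool :=
  (blocks p == blocks q) &&
  [forall (B | (B \in blocks p) && (ord0 \notin B)),
    exists w : 'Z_d, wblock q B == shift w (wblock p B)].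

Definition wle n d (p q : wpartition n d) : bool :=
  [forall B in blocks p, exists C in blocks q,
    (erase (wblock p B) \subset wblock q C) ||
    [exists w : 'Z_d, shift w (wblock p B) \subset wblock q C]].

(** No exception is needed for the zero block, where all these numbers are 0. *)
Definition wbalanced n d (p : wpartition n d) : bool :=
  [forall B in blocks p, forall a : 'Z_d, forall b : 'Z_d,
    #|[set x in wblock p B | x.2 == Some a]|
      == #|[set x in wblock p B | x.2 == Some b]|].

Lemma blocksP n d (p : wpartition n d) : partition (blocks p) setT.
Proof. by case/andP: (wpart_valP p). Qed.

Lemma weightP n d (p : wpartition n d) x :
  (weight p x == None) = (x \in pblock (blocks p) ord0).
Proof. by case/andP: (wpart_valP p) => _ /forallP/(_ x)/eqP. Qed.

Lemma blocks_def n d (p : wpartition n d) B x :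
  B \in blocks p -> x \in B -> pblock (blocks p) x = B.
Proof. by case/and3P: (blocksP p) => _ tI _; exact: def_pblock tI. Qed.

Lemma block_neq0 n d (p : wpartition n d) B :
  B \in blocks p -> exists x, x \in B.
Proof.
move=> BP; apply/set0Pn; apply: contraTneq BP => ->.
by case/and3P: (blocksP p).
Qed.

Lemma weight_None n d (p : wpartition n d) B x :
  B \in blocks p -> x \in B -> (weight p x == None) = (ord0 \in B).
Proof.
move=> BP xB; rewrite weightP; have [_ tI _] := and3P (blocksP p).
have cov y : y \in cover (blocks p) by rewrite (cover_partition (blocksP p)) inE.
apply/idP/idP => [x0 | z].
  by rewrite -(blocks_def BP xB) (same_pblock tI x0) mem_pblock.
by rewrite (blocks_def BP z).
Qed.

Lemma in_wblock n d (p : wpartition n d) B (y : welt n d) :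
  (y \in wblock p B) = (y.1 \in B) && (y.2 == weight p y.1).
Proof.
case: y => y a; apply/imsetP/andP => /=; last first.
  by case=> yB /eqP ->; exists y.
by case=> x xB [-> ->]; rewrite eqxx.
Qed.

Lemma sub_eraseP n d (p q : wpartition n d) (B C : {set 'I_n.+1}) :
  reflect (forall x, x \in B -> x \in C /\ weight q x = None)
          (erase (wblock p B) \subset wblock q C).
Proof.
apply: (iffP subsetP) => [sub x xB | sub _ /imsetP[_ /imsetP[x xB ->] ->]].
  have: (x, None) \in erase (wblock p B).
    by apply/imsetP; exists (x, weight p x) => //; apply: imset_f.
  by move/sub; rewrite in_wblock /= => /andP[-> /eqP <-].
by have [xC wx] := sub x xB; rewrite in_wblock /= xC wx eqxx.
Qed.

Lemma sub_shiftP n d (p q : wpartition n d) (B C : {set 'I_n.+1}) w :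
  reflect (forall x, x \in B -> x \in C /\ weight q x = omap (+%R^~ w) (weight p x))
          (shift w (wblock p B) \subset wblock q C).
Proof.
apply: (iffP subsetP) => [sub x xB | sub _ /imsetP[_ /imsetP[x xB ->] ->]].
  have: (x, omap (+%R^~ w) (weight p x)) \in shift w (wblock p B).
    by apply/imsetP; exists (x, weight p x) => //; apply: imset_f.
  by move/sub; rewrite in_wblock /= => /andP[-> /eqP <-].
by have [xC wx] := sub x xB; rewrite in_wblock /= xC wx eqxx.
Qed.

Lemma wleP n d (p q : wpartition n d) :
  reflect (forall B, B \in blocks p -> exists C, [/\ C \in blocks q, B \subset C &
             (forall x, x \in B -> weight q x = None) \/
             (exists w, forall x, x \in B ->
                weight q x = omap (+%R^~ w) (weight p x))])
          (wle p q).
Proof.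
apply: (iffP forall_inP) => pq B BP.
  have /exists_inP[C CQ /orP[/sub_eraseP sub | /existsP[w /sub_shiftP sub]]] := pq B BP.
    exists C; split=> //; first by apply/subsetP => x /sub[].
    by left=> x /sub[].
  exists C; split=> //; first by apply/subsetP => x /sub[].
  by right; exists w => x /sub[].
have [C [CQ /subsetP BC wts]] := pq B BP; apply/exists_inP; exists C => //.
case: wts => [wt0 | [w wtw]]; apply/orP.
  by left; apply/sub_eraseP => x xB; split; [exact: BC | exact: wt0].
right; apply/existsP; exists w; apply/sub_shiftP => x xB.
by split; [exact: BC | exact: wtw].
Qed.

Lemma shift_wblockP n d (p q : wpartition n d) (B : {set 'I_n.+1}) w :
  reflect (forall x, x \in B -> weight q x = omap (+%R^~ w) (weight p x))
          (wblock q B == shift w (wblock p B)).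
Proof.
apply: (iffP eqP) => [eqB x xB | eqw].
  by have /sub_shiftP/(_ x xB)[] : shift w (wblock p B) \subset wblock q B by rewrite eqB.
rewrite /shift /wblock -imset_comp; apply: eq_in_imset => x xB /=.
by rewrite eqw.
Qed.

Lemma wequivP n d (p q : wpartition n d) :
  reflect (blocks p = blocks q /\ forall B, B \in blocks p -> exists w,
             forall x, x \in B -> weight q x = omap (+%R^~ w) (weight p x))
          (wequiv p q).
Proof.
apply: (iffP andP) => [[/eqP eP /forall_inP eqw] | [eP eqw]]; split=> //.
- move=> B BP; have [z | nz] := boolP (ord0 \in B); last first.
    have /existsP[w /shift_wblockP wB] : [exists w : 'Z_d, wblock q B == shift w (wblock p B)].
      by apply: eqw; rewrite BP nz.
    by exists w.
  exists 0 => x xB; have BQ : B \in blocks q by rewrite -eP.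
  have /eqP -> : weight q x == None by rewrite (weight_None BQ xB).
  by have /eqP -> : weight p x == None by rewrite (weight_None BP xB).
- exact/eqP.
- apply/forall_inP => B /andP[BP _]; have [w wB] := eqw B BP.
  by apply/existsP; exists w; apply/shift_wblockP.
Qed.

Lemma wequiv_sym n d : symmetric (@wequiv n d).
Proof.
suff imp (p q : wpartition n d) : wequiv p q -> wequiv q p.
  by move=> p q; apply/idP/idP; exact: imp.
move=> /wequivP[eP eqw]; apply/wequivP; rewrite -eP; split=> // B /eqw[w wB].
exists (- w) => x /wB ->; case: (weight p x) => //= a.
by rewrite addrK.
Qed.

Lemma wequiv_wle n d (p q : wpartition n d) : wequiv p q -> wle p q.
Proof.
case/wequivP=> eP eqw; apply/wleP => B BP; exists B; rewrite -eP; split=> //.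
by right; exact: eqw.
Qed.

Lemma wle_blocks n d (p q : wpartition n d) : wle p q -> wle q p ->
  {subset blocks p <= blocks q}.
Proof.
move=> /wleP pq /wleP qp B BP; have [C [CQ BC _]] := pq B BP.
have [B' [B'P CB' _]] := qp C CQ; have [x xB] := block_neq0 BP.
have eB : B' = B.
  rewrite -(blocks_def BP xB); apply/esym/(blocks_def B'P).
  by apply: (subsetP CB'); apply: (subsetP BC).
suff -> : B = C by [].
by apply/eqP; rewrite eqEsubset BC -eB.
Qed.

Lemma wequivE n d (p q : wpartition n d) : wequiv p q = wle p q && wle q p.
Proof.
apply/idP/andP => [pq | [pq qp]].
  by split; apply: wequiv_wle => //; rewrite wequiv_sym.
have eP : blocks p = blocks q.
  by apply/setP => B; apply/idP/idP; exact: wle_blocks.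
apply/wequivP; split=> // B BP.
have /wleP/(_ B BP)[C [CQ BC [wt0 | //]]] := pq.
have BQ : B \in blocks q by rewrite -eP.
exists 0 => x xB; rewrite wt0 //.
have z : ord0 \in B by rewrite -(weight_None BQ xB) wt0.
by have /eqP -> : weight p x == None by rewrite (weight_None BP xB).
Qed.

Lemma wle_refl n d : reflexive (@wle n d).
Proof.
move=> p; apply/wleP => B BP; exists B; split=> //.
by right; exists 0 => x _; case: (weight p x) => //= a; rewrite addr0.
Qed.

Lemma wle_trans n d : transitive (@wle n d).
Proof.
move=> q p r /wleP pq /wleP qr; apply/wleP => B BP.
have [C [CQ /subsetP BC wBC]] := pq B BP; have [D [DR /subsetP CD wCD]] := qr C CQ.
exists D; split=> //; first by apply/subsetP => x /BC/CD.
case: wCD => [wt0 | [w wtw]]; first by left=> x /BC/wt0.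
case: wBC => [wt0 | [v wtv]].
  by left=> x xB; rewrite (wtw _ (BC _ xB)) wt0.
right; exists (v + w) => x xB; rewrite (wtw _ (BC _ xB)) wtv //.
by case: (weight p x) => //= a; rewrite addrA.
Qed.

Lemma wequiv_refl n d : reflexive (@wequiv n d).
Proof. by move=> p; rewrite wequivE !wle_refl. Qed.

Lemma wequiv_trans n d : transitive (@wequiv n d).
Proof.
move=> q p r; rewrite !wequivE => /andP[pq qp] /andP[qr rq].
by rewrite (wle_trans pq qr) (wle_trans rq qp).
Qed.

Lemma wle_equiv n d (p p' q q' : wpartition n d) :
  wequiv p p' -> wequiv q q' -> wle p q = wle p' q'.
Proof.
rewrite !wequivE => /andP[pp' p'p] /andP[qq' q'q].
apply/idP/idP => le1; first exact: wle_trans p'p (wle_trans le1 qq').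
exact: wle_trans pp' (wle_trans le1 q'q).
Qed.

Lemma wbalanced_equiv n d (p q : wpartition n d) :
  wequiv p q -> wbalanced p = wbalanced q.
Proof.
have imp (p' q' : wpartition n d) : wequiv p' q' -> wbalanced p' -> wbalanced q'.
  move=> /wequivP[eP eqw] /forall_inP bal; apply/forall_inP => B.
  rewrite -eP => BP; have [w wB] := eqw B BP.
  have card a : #|[set x in wblock q' B | x.2 == Some a]|
              = #|[set x in wblock p' B | x.2 == Some (a - w)]|.
    pose f (x : welt n d) : welt n d := (x.1, omap (+%R^~ w) x.2).
    have f_inj : injective f.
      move=> [x u] [y v] e; have /= -> := congr1 fst e.
      move/(congr1 snd): e => /=; case: u v => [u|] [v|] //= /Some_inj /addIr.
      by move=> ->.
    rewrite -[RHS](card_imset _ f_inj); congr #|pred_of_set _|.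
    apply/setP => -[x c]; rewrite !inE in_wblock /=; apply/idP/imsetP.
      case/andP=> /andP[xB /eqP ->] /eqP wx.
      exists (x, Some (a - w)); last by rewrite /f /= subrK wx.
      rewrite inE in_wblock /= xB eqxx andbT /=.
      move: wx; rewrite wB //; case: (weight p' x) => //= b [<-].
      by rewrite addrK.
    case=> -[y b]; rewrite inE in_wblock /= => /andP[/andP[yB /eqP wy] /eqP by'] [-> ->].
    by rewrite yB wB //= -wy by' /= subrK !eqxx.
  apply/forallP => a; apply/forallP => b; rewrite !card.
  by have /forallP/(_ (a - w))/forallP/(_ (b - w)) := bal B BP.
by move=> pq; apply/idP/idP; apply: imp; rewrite // wequiv_sym.
Qed.

(** The permutation of [{0, .., n}] that fixes 0 and acts as [s] on [{1, .., n}];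
    the basis vector of index [i : 'I_n] of the representation corresponds to
    the element [lift ord0 i]. *)
Definition perm0 n (s : 'S_n) : 'S_n.+1 := lift_perm ord0 ord0 s.

Definition wact_val n d (p : wpartition n d) (s : 'S_n) :
    {set {set 'I_n.+1}} * {ffun 'I_n.+1 -> option 'Z_d} :=
  ([set perm0 s @: B | B : {set 'I_n.+1} in blocks p],
   [ffun x => weight p ((perm0 s)^-1%g x)]).

Fact wact_subproof n d (p : wpartition n d) (s : 'S_n) :
  is_wpartition (wact_val p s).
Proof.
have [cov tI P0] := and3P (blocksP p).
set t := perm0 s; have injt : injective t by exact: perm_inj.
have tI' : trivIset [set t @: B | B : {set 'I_n.+1} in blocks p].
  apply/trivIsetP => _ _ /imsetP[A AP ->] /imsetP[B BP ->] AB.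
  rewrite imset_disjoint //; move/trivIsetP: tI; apply=> //.
  by apply: contraNneq AB => ->.
have part : partition [set t @: B | B : {set 'I_n.+1} in blocks p] setT.
  apply/and3P; split=> //.
    rewrite eqEsubset subsetT; apply/subsetP => x _; apply/bigcupP.
    have xc : t^-1%g x \in cover (blocks p) by rewrite (eqP cov) inE.
    exists (t @: pblock (blocks p) (t^-1%g x)).
      by apply: imset_f; exact: pblock_mem.
    by rewrite -{1}(permKV t x) imset_f // mem_pblock.
  apply: contra P0 => /imsetP[B BP] /esym/eqP.
  by rewrite imset_eq0 => /eqP <-.
apply/andP; split; first exact: part.
apply/forallP => x; rewrite ffunE weightP; apply/eqP.
have zc : ord0 \in cover (blocks p) by rewrite (eqP cov) inE.
have -> : pblock (wact_val p s).1 ord0 = t @: pblock (blocks p) ord0.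
  apply: def_pblock; first exact: tI'.
    by apply: imset_f; exact: pblock_mem.
  have t0 : t ord0 = ord0 by exact: lift_perm_id.
  by rewrite -{1}t0 imset_f // mem_pblock.
by rewrite -{2}(permKV t x) (mem_imset _ _ injt).
Qed.

Definition wact n d (p : wpartition n d) (s : 'S_n) : wpartition n d :=
  WPartition (wact_subproof p s).

Lemma perm01 n : perm0 (1%g : 'S_n) = 1%g.
Proof. exact: lift_perm1. Qed.

Lemma perm0M n (s t : 'S_n) : perm0 (s * t)%g = (perm0 s * perm0 t)%g.
Proof. by rewrite /perm0 -(lift_permM ord0 ord0 ord0). Qed.

Fact wact1 n d (p : wpartition n d) : wact p 1%g = p.
Proof.
apply/val_inj; rewrite /= /wact_val perm01; case: p => -[P wt] pP /=.
congr pair; last by apply/ffunP => x; rewrite ffunE invg1 perm1.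
rewrite /blocks /=; rewrite -[RHS]imset_id; apply: eq_imset => B.
by rewrite -[RHS]imset_id; apply: eq_imset => x; rewrite perm1.
Qed.

Fact wactM n d (p : wpartition n d) : act_morph (@wact n d) p.
Proof.
move=> s t; apply/val_inj; rewrite /= /wact_val perm0M; congr pair.
  rewrite /blocks /= -imset_comp; apply: eq_imset => B /=.
  by rewrite -imset_comp; apply: eq_imset => x; rewrite permM.
by apply/ffunP => x; rewrite /weight /= !ffunE invMg permM.
Qed.

Lemma wle_act n d (p q : wpartition n d) s : wle p q -> wle (wact p s) (wact q s).
Proof.
move/wleP=> pq; apply/wleP => _ /imsetP[B BP ->].
have [C [CQ BC wts]] := pq B BP; exists (perm0 s @: C); split.
- exact: imset_f.
- exact: imsetS.
- case: wts => [wt0 | [w wtw]].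
    by left=> _ /imsetP[x xB ->]; rewrite ffunE permK wt0.
  by right; exists w => _ /imsetP[x xB ->]; rewrite !ffunE permK wtw.
Qed.

Lemma wequiv_act n d (p q : wpartition n d) s :
  wequiv p q -> wequiv (wact p s) (wact q s).
Proof. by rewrite !wequivE => /andP[pq qp]; rewrite !wle_act. Qed.

Lemma wbalanced_act n d (p : wpartition n d) s : wbalanced p -> wbalanced (wact p s).
Proof.
move=> /forall_inP bal; apply/forall_inP => _ /imsetP[B BP ->].
pose f (x : welt n d) : welt n d := (perm0 s x.1, x.2).
have f_inj : injective f by move=> [x u] [y v] [] /perm_inj -> ->.
have wB : wblock (wact p s) (perm0 s @: B) = f @: wblock p B.
  rewrite /wblock -!imset_comp; apply: eq_imset => x.
  by rewrite /f /= ffunE permK.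
have card a : #|[set x in wblock (wact p s) (perm0 s @: B) | x.2 == Some a]|
            = #|[set x in wblock p B | x.2 == Some a]|.
  rewrite wB -[RHS](card_imset _ f_inj); congr #|pred_of_set _|.
  apply/setP => x; rewrite inE; apply/andP/imsetP.
    by case=> /imsetP[y yB ->] ya; exists y; rewrite // inE yB.
  by case=> y; rewrite inE => /andP[yB ya] ->; rewrite (imset_f f).
apply/forallP => a; apply/forallP => b; rewrite !card.
by have /forallP/(_ a)/forallP/(_ b) := bal B BP.
Qed.

(** * The Dowling lattice *)

Canonical wequiv_equiv n d :=
  EquivRel (@wequiv n d) (@wequiv_refl n d) (@wequiv_sym n d) (@wequiv_trans n d).

Definition dowling n d := {eq_quot (@wequiv n d)}%qT.

HB.instance Definition _ n d := Choice.on (dowling n d).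
HB.instance Definition _ n d := EqQuotient.on (dowling n d).

Local Open Scope quotient_scope.

(** [repr] alone refers to representatives of group cosets here. *)
Local Notation qrepr := generic_quotient.repr.

Lemma repr_wequiv n d (p : wpartition n d) : wequiv (qrepr (\pi_(dowling n d) p)) p.
Proof. by apply/eqmodP; rewrite reprK. Qed.

Fact dowling_display : Order.disp_t. Proof. exact: (Order.Disp tt tt). Qed.

Definition dowling_le n d (x y : dowling n d) : bool := wle (qrepr x) (qrepr y).

Fact dowling_le_refl n d : reflexive (@dowling_le n d).
Proof. by move=> x; exact: wle_refl. Qed.

Fact dowling_le_anti n d : antisymmetric (@dowling_le n d).
Proof.
move=> x y; rewrite /dowling_le -wequivE => xy.
by rewrite -(reprK x) -(reprK y); apply/eqmodP.
Qed.

Fact dowling_le_trans n d : transitive (@dowling_le n d).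
Proof. by move=> y x z; exact: wle_trans. Qed.

HB.instance Definition _ n d :=
  Order.Le_isPOrder.Build dowling_display (dowling n d)
    (@dowling_le_refl n d) (@dowling_le_anti n d) (@dowling_le_trans n d).

Lemma dowling_leE n d (p q : wpartition n d) :
  (\pi_(dowling n d) p <= \pi_(dowling n d) q)%O = wle p q.
Proof. by apply: wle_equiv; exact: repr_wequiv. Qed.

Definition dowling_act n d (x : dowling n d) (s : 'S_n) : dowling n d :=
  \pi_(dowling n d) (wact (qrepr x) s).

Lemma dowling_actE n d (p : wpartition n d) s :
  dowling_act (\pi_(dowling n d) p) s = \pi_(dowling n d) (wact p s).
Proof. by apply/eqmodP/wequiv_act/repr_wequiv. Qed.

Fact dowling_act1 n d (x : dowling n d) : dowling_act x 1%g = x.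
Proof. by rewrite /dowling_act wact1 reprK. Qed.

Fact dowling_actM n d (x : dowling n d) : act_morph (@dowling_act n d) x.
Proof. by move=> s t; rewrite -(reprK x) !dowling_actE wactM reprK. Qed.

Definition dowling_action n d : {action 'S_n &-> dowling n d} :=
  TotalAction (@dowling_act1 n d) (@dowling_actM n d).

Definition balanced n d (x : dowling n d) : bool := wbalanced (qrepr x).

Lemma balancedE n d (p : wpartition n d) :
  balanced (\pi_(dowling n d) p) = wbalanced p.
Proof. by apply: wbalanced_equiv; exact: repr_wequiv. Qed.

(** * The poset of balanced partitions *)

Record bdowling n d := BDowling {
  bd_val :> dowling n d;
  bd_valP : balanced bd_val }.

HB.instance Definition _ n d := [isSub for @bd_val n d].
HB.instance Definition _ n d := [Choice of bdowling n d by <:].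
HB.instance Definition _ n d :=
  [SubChoice_isSubPOrder of bdowling n d by <: with dowling_display].

Fact bdowling_act_subproof n d (x : bdowling n d) s : balanced (dowling_act x s).
Proof. by rewrite balancedE; apply: wbalanced_act; exact: bd_valP. Qed.

Definition bdowling_act n d (x : bdowling n d) (s : 'S_n) : bdowling n d :=
  BDowling (bdowling_act_subproof x s).

Fact bdowling_act1 n d (x : bdowling n d) : bdowling_act x 1%g = x.
Proof. by apply/val_inj; exact: dowling_act1. Qed.

Fact bdowling_actM n d (x : bdowling n d) : act_morph (@bdowling_act n d) x.
Proof. by move=> s t; apply/val_inj; exact: dowling_actM. Qed.

Definition bdowling_action n d : {action 'S_n &-> bdowling n d} :=
  TotalAction (@bdowling_act1 n d) (@bdowling_actM n d).

Lemma bdowling_action_le n d s :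
  {mono (bdowling_action n d)^~ s : x y / (x <= y)%O}.
Proof.
apply: homo_act_mono => {}s x y; rewrite !Order.SubPreorderTheory.leEsub /=.
rewrite -{1}(reprK (bd_val x)) -{1}(reprK (bd_val y)) !dowling_leE.
exact: wle_act.
Qed.

(* Main.v *)
(** Every subspace V(g, zeta) determines a weighted partition: the zero block
    collects the coordinates that vanish on it, two other coordinates share a
    block when they are proportional on it by a power of zeta, and the weights
    record these powers. As g maps each block to itself and lowers all weights
    by 1, the partition is balanced. Conversely a weighted partition is the set of
    equations [solves], its order is reverse inclusion of the solution spaces
    (tested on the vectors supported by one block), and for a balanced partition
    the solution space is V(g, zeta), where g runs cyclically through every
    nonzero block, lowering the weight by 1 at each step. *)

Require Import Defs.
From mathcomp Require Import all_boot all_order all_algebra all_fingroup.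
From mathcomp Require Import reals complex boolp.

Set Implicit Arguments.
Unset Strict Implicit.
Unset Printing Implicit Defensive.

Import Order.TTheory GRing.Theory.

Section Correspondence.

Local Open Scope ring_scope.

Variables (F : fieldType) (n d : nat) (zeta : F).
Hypotheses (d_gt1 : (1 < d)%N) (zeta_prim : d.-primitive_root zeta).

Implicit Types (p q : wpartition n d) (v : 'cV[F]_n) (a b w : 'Z_d).
Implicit Types (x y : 'I_n.+1) (B C : {set 'I_n.+1}) (g s : 'S_n).

(** * Powers of [zeta] as a character of Z/dZ; vectors as functions on {0, .., n} *)

Let chi a : F := zeta ^+ a.

Lemma chi_nat (k : nat) : chi k%:R = zeta ^+ k.
Proof. by rewrite /chi val_Zp_nat // prim_expr_mod. Qed.

Lemma chiD a b : chi (a + b) = chi a * chi b.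
Proof. by rewrite -[a]natr_Zp -[b]natr_Zp -natrD !chi_nat exprD. Qed.

Lemma chi0 : chi 0 = 1.
Proof. exact: (chi_nat 0). Qed.

Lemma chi_neq0 a : chi a != 0.
Proof.
rewrite expf_neq0 //; apply/eqP => z0; have /eqP := prim_expr_order zeta_prim.
by rewrite z0 expr0n (gtn_eqF (ltnW d_gt1)) eq_sym oner_eq0.
Qed.

Lemma chi_inj : injective chi.
Proof.
move=> a b /eqP; rewrite (eq_prim_root_expr zeta_prim) => /eqP ab.
by rewrite -[a]natr_Zp -[b]natr_Zp -(Zp_nat_mod d_gt1 a) ab Zp_nat_mod.
Qed.

Lemma chiBMzeta a : chi (a - 1) * zeta = chi a.
Proof. by rewrite -[X in _ * X]expr1 -(chi_nat 1) -chiD subrK. Qed.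

(* The value 0 at the element 0 makes it an ordinary member of the zero block. *)
Definition coord0 v x : F := if unlift ord0 x is Some i then v i 0 else 0.

Lemma coord00 v : coord0 v ord0 = 0.
Proof. by rewrite /coord0 unlift_none. Qed.

Lemma coord0_lift v i : coord0 v (lift ord0 i) = v i 0.
Proof. by rewrite /coord0 liftK. Qed.

Lemma coord0_col (c : 'I_n.+1 -> F) x :
  c ord0 = 0 -> coord0 (\col_i c (lift ord0 i)) x = c x.
Proof.
by move=> c0; case: (unliftP ord0 x) => [i|] ->; rewrite ?coord00 // coord0_lift mxE.
Qed.

Lemma perm00 s : perm0 s ord0 = ord0.
Proof. exact: lift_perm_id. Qed.

Lemma coord0_perm s v x : coord0 (perm_vect s v) (perm0 s x) = coord0 v x.
Proof.
case: (unliftP ord0 x) => [i|] ->; last by rewrite perm00 !coord00.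
by rewrite lift_perm_lift !coord0_lift perm_vectE.
Qed.

Lemma perm0_exists (t : 'S_n.+1) : t ord0 = ord0 -> exists s, perm0 s = t.
Proof.
move=> t0; pose f i := odflt i (unlift ord0 (t (lift ord0 i))).
have fE i : lift ord0 (f i) = t (lift ord0 i).
  rewrite /f; case: unliftP => [j -> //|].
  by rewrite -{2}t0 => /perm_inj/eqP; rewrite eq_sym (negPf (neq_lift _ _)).
have f_inj : injective f.
  by move=> i j /(congr1 (lift ord0)); rewrite !fE => /perm_inj/lift_inj.
exists (perm f_inj); apply/permP => x.
by case: (unliftP ord0 x) => [i|] ->; rewrite ?perm00 // lift_perm_lift permE.
Qed.

Lemma mem_VspaceP g v :
  reflect (forall x, coord0 v (perm0 g x) * zeta = coord0 v x)
          (v \in Vspace zeta g).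
Proof.
rewrite memVspace; apply: (iffP eqP) => [gv x | gv].
  rewrite -[RHS](coord0_perm g) gv; set y := perm0 g x.
  case: (unliftP ord0 y) => [i|] ->; last by rewrite !coord00 mul0r.
  by rewrite !coord0_lift mxE mulrC.
apply/colP => i; rewrite -(permKV g i) perm_vectE mxE mulrC.
by rewrite -!coord0_lift -gv lift_perm_lift.
Qed.

(* v lies in the subspace attached to p: it vanishes on the zero block, and
   within a nonzero block v x is proportional to zeta ^+ weight p x. *)
Definition solves p v : Prop :=
  (forall x, weight p x = None -> coord0 v x = 0) /\
  (forall B x y a b, B \in blocks p -> x \in B -> y \in B ->
     weight p x = Some a -> weight p y = Some b ->
     coord0 v x * chi b = coord0 v y * chi a).

(** * Order of weighted partitions and inclusion of solution spaces *)

Lemma mem_pblock0 p x : x \in pblock (blocks p) x.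
Proof. by rewrite mem_pblock (cover_partition (blocksP p)) inE. Qed.

Lemma pblock_blocks p x : pblock (blocks p) x \in blocks p.
Proof. by rewrite pblock_mem // (cover_partition (blocksP p)) inE. Qed.

(** A shift by [w] multiplies both sides of an equation by the nonzero [chi w]; where weights are
    erased, both sides are 0. *)
Lemma wle_solves p q v : wle p q -> solves q v -> solves p v.
Proof.
move=> /wleP pq [q0 qB]; split.
  move=> x /eqP px; have [C [CQ BC _]] := pq _ (pblock_blocks p x).
  apply/q0/eqP; rewrite (weight_None CQ) ?(subsetP BC) ?mem_pblock0 //.
  by rewrite -(weight_None (pblock_blocks p x) (mem_pblock0 p x)).
move=> B x y a b BP xB yB wx wy; have [C [CQ /subsetP BC [w0 | [w wq]]]] := pq B BP.
  by rewrite !q0 ?mul0r ?w0.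
apply: (mulIf (chi_neq0 w)); rewrite -!mulrA -!chiD.
by apply: (qB C) => //; rewrite ?BC // wq // ?wx ?wy.
Qed.

Definition block_coord q C x : F :=
  if x \in C then oapp chi 0 (weight q x) else 0.

Lemma block_coord_neq0 q C x :
  (block_coord q C x != 0) = (x \in C) && (weight q x != None).
Proof.
rewrite /block_coord; case: ifP; rewrite ?eqxx //.
by case: (weight q x) => /= [a|]; rewrite ?eqxx // chi_neq0.
Qed.

Lemma weight_ord0 q : weight q ord0 = None.
Proof. by apply/eqP; rewrite weightP mem_pblock0. Qed.

Lemma solves_block_coord q C : C \in blocks q ->
  let v := \col_i block_coord q C (lift ord0 i) in
  solves q v /\ forall x, coord0 v x = block_coord q C x.
Proof.
move=> CQ v; have vE x : coord0 v x = block_coord q C x.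
  by rewrite coord0_col // /block_coord weight_ord0; case: ifP.
split=> //; split=> [x wx | B x y a b BQ xB yB wx wy]; rewrite !vE /block_coord.
  by rewrite wx; case: ifP.
rewrite wx wy /=; have [xC | xC] := boolP (x \in C).
  by rewrite -(blocks_def CQ xC) (blocks_def BQ xB) yB mulrC.
case: ifP; rewrite !mul0r // => yC; case/negP: xC.
by rewrite -(blocks_def CQ yC) (blocks_def BQ yB).
Qed.

(** If some [x] in [B] has a weight in [q], the test vector [block_coord q C] of its block [C] is
    nonzero at [x]. The equations of [p] then make it nonzero on all of [B], so [B] lies in [C], and
    comparing exponents gives the constant shift [a' - a]. *)
Lemma solves_wle p q : (forall v, solves q v -> solves p v) -> wle p q.
Proof.
move=> qp; apply/wleP => B BP.
have [/forall_inP w0 | ] := boolP [forall y in B, weight q y == None].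
  exists (pblock (blocks q) ord0); split; first exact: pblock_blocks.
    by apply/subsetP => y /w0; rewrite weightP.
  by left=> y /w0/eqP.
rewrite negb_forall_in => /exists_inP[x xB wx].
set C := pblock (blocks q) x; have CQ : C \in blocks q by exact: pblock_blocks.
have xC : x \in C by exact: mem_pblock0.
have [/qp[p0 pB] vE] := solves_block_coord CQ.
have ex : block_coord q C x != 0 by rewrite block_coord_neq0 xC.
have nz : ord0 \notin B.
  rewrite -(weight_None BP xB); apply: contraNN ex => /eqP/p0.
  by rewrite vE => ->.
have pwt y : y \in B -> exists b, weight p y = Some b.
  move=> yB; move: (weight_None BP yB); rewrite (negPf nz).
  by case: (weight p y) => // b _; exists b.
have [a px] := pwt x xB.
case qx: (weight q x) wx => [a'|] // _.
have qwt y b : y \in B -> weight p y = Some b ->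
    y \in C /\ weight q y = Some (b + (a' - a)).
  move=> yB py; have := pB B x y a b BP xB yB px py; rewrite !vE => exy.
  have : block_coord q C y != 0.
    apply: contraNneq (mulf_neq0 ex (chi_neq0 b)) => ey.
    by rewrite exy ey mul0r.
  rewrite block_coord_neq0 => /andP[yC wy]; split=> //.
  move: wy exy; rewrite /block_coord xC yC qx.
  case: (weight q y) => //= b' _; rewrite -!chiD => /chi_inj e.
  by rewrite addrA [b + a']addrC e addrK.
exists C; split=> //.
  by apply/subsetP => y yB; have [b py] := pwt y yB; case: (qwt y b).
right; exists (a' - a) => y yB; have [b py] := pwt y yB.
by rewrite py /=; case: (qwt y b).
Qed.

Lemma solves_wact p s v : solves (wact p s) (perm_vect s v) <-> solves p v.
Proof.
have wE x : weight (wact p s) (perm0 s x) = weight p x by rewrite ffunE permK.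
split=> -[p0 pB]; split.
- by move=> x px; rewrite -(coord0_perm s) p0 // wE.
- move=> B x y a b BP xB yB px py.
  rewrite -(coord0_perm s v x) -(coord0_perm s v y).
  by apply: (pB (perm0 s @: B)); rewrite ?imset_f ?wE // (imset_f (fun C => _ @: C)).
- by move=> x; rewrite -(permKV (perm0 s) x) wE coord0_perm => /p0.
- move=> _ x y a b /imsetP[B BP ->] /imsetP[x' xB ->] /imsetP[y' yB ->].
  rewrite !wE !coord0_perm; exact: (pB B).
Qed.


(** * Balance and permutations that lower weights *)

Definition wclass p B a := [set x in B | weight p x == Some a].

Lemma wbalancedP p :
  reflect (forall B a b, B \in blocks p -> #|wclass p B a| = #|wclass p B b|)
          (wbalanced p).
Proof.
have cardE B a : #|[set x in wblock p B | x.2 == Some a]| = #|wclass p B a|.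
  have inj : injective (fun x => (x, weight p x)) by move=> x y [].
  rewrite -(card_imset _ inj); congr #|pred_of_set _|.
  apply/setP => -[x u]; rewrite inE in_wblock /=; apply/idP/imsetP.
    case/andP=> /andP[xB /eqP ->] wx; exists x => //.
    by rewrite inE xB.
  by case=> y; rewrite inE => /andP[yB wy] [-> ->]; rewrite yB eqxx.
apply: (iffP forall_inP) => [bal B a b BP | bal B BP].
  by have /forallP/(_ a)/forallP/(_ b)/eqP := bal B BP; rewrite !cardE.
by apply/forallP => a; apply/forallP => b; rewrite !cardE; apply/eqP/bal.
Qed.

Definition lowers_weight p g : Prop := forall x,
  perm0 g x \in pblock (blocks p) x /\
  weight p (perm0 g x) = omap (+%R^~ (- 1)) (weight p x).

(** [g] injects the class of weight [a] into that of weight [a - 1]; going round Z/dZ, each class is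
    at most as large as any other. *)
Lemma lowers_weight_balanced p g : lowers_weight p g -> wbalanced p.
Proof.
move=> gP; apply/wbalancedP => B + + BP.
have le1 a : (#|wclass p B a| <= #|wclass p B (a - 1)%R|)%N.
  rewrite -(card_imset _ (@perm_inj _ (perm0 g))); apply/subset_leq_card/subsetP.
  move=> _ /imsetP[x + ->]; rewrite !inE => /andP[xB /eqP wx].
  by have [] := gP x; rewrite (blocks_def BP xB) wx => -> ->; rewrite eqxx.
have lek a k : (#|wclass p B a| <= #|wclass p B (a - k%:R)%R|)%N.
  elim: k => [|k IHk]; first by rewrite subr0.
  by apply: leq_trans IHk (leq_trans (le1 _) _); rewrite -natr1 opprD addrA.
have le a b : (#|wclass p B a| <= #|wclass p B b|)%N.
  by have := lek a (a - b : 'Z_d); rewrite natr_Zp subKr.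
by move=> a b; apply/eqP; rewrite eqn_leq !le.
Qed.

(** After cancelling a power of [zeta], the equation of [p] between [x] and its image under [g] is
    the eigenvector equation at [x]. *)
Lemma lowers_weight_solves p g v :
  lowers_weight p g -> solves p v -> v \in Vspace zeta g.
Proof.
move=> gP [p0 pB]; apply/mem_VspaceP => x; have [gx] := gP x.
case px: (weight p x) => [a|] /= pg; last by rewrite !p0 ?mul0r.
have := pB _ _ _ _ _ (pblock_blocks p x) gx (mem_pblock0 p x) pg px.
rewrite -(chiBMzeta a) [chi _ * zeta]mulrC mulrA; exact: (mulIf (chi_neq0 _)).
Qed.

(** * The weighted partition of a subspace *)

Definition prop_on (U : {vspace 'cV[F]_n}) a x y : Prop :=
  forall v, v \in U -> coord0 v y = coord0 v x * chi a.

Definition prop_rel U : rel 'I_n.+1 :=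
  fun x y => `[< exists a, prop_on U a x y >].

Lemma prop_rel_equiv U : equivalence_rel (prop_rel U).
Proof.
apply/equivalence_relP; split.
  by move=> x; apply/asboolP; exists 0 => v _; rewrite chi0 mulr1.
apply: sym_left_transitive.
  suff sym x y : prop_rel U x y -> prop_rel U y x.
    by move=> x y; apply/idP/idP; exact: sym.
  move=> /asboolP[a xy]; apply/asboolP; exists (- a) => v /xy ->.
  by rewrite -mulrA -chiD subrr chi0 mulr1.
move=> y x z /asboolP[a xy] /asboolP[b yz]; apply/asboolP.
by exists (a + b) => v vU; rewrite yz // xy // chiD mulrA.
Qed.

Lemma prop_rel0 U x : prop_rel U ord0 x -> forall v, v \in U -> coord0 v x = 0.
Proof. by move=> /asboolP[a x0] v /x0 ->; rewrite coord00 mul0r. Qed.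

(** Blocks are the classes of [prop_rel U]; the weight of [x] is the exponent of its ratio to a
    representative [r x] of its class. Outside the zero block this exponent is unique, whence the
    last clause. *)
Lemma prop_partition U : exists p,
  [/\ forall x y, (y \in pblock (blocks p) x) = prop_rel U x y,
      forall v, v \in U -> solves p v
    & forall x y a b w, weight p x = Some a -> weight p y = Some b ->
        prop_on U w x y -> b = a + w].
Proof.
have eqR := prop_rel_equiv U; set R := prop_rel U in eqR *.
have eqR' : {in [set: 'I_n.+1] & &, equivalence_rel R} by move=> x y z _ _ _.
pose r x := choose (R x) x.
have Rr x : R x (r x) by apply: chooseP; rewrite /= eqR.
have Rxx x : R x x := (eqR x x x).1.
have Rsym x y : R x y = R y x.
  by apply/idP/idP => xy; [rewrite -((eqR x y x).2 xy) | rewrite -((eqR y x y).2 xy)].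
(* [choose] depends neither on the starting point nor on the form of the predicate, so [r] is
   constant on classes. *)
have rE x y : R x y -> r x = r y.
  move=> xy; have eRxy : R x =1 R y by move=> z; rewrite ((eqR x y z).2 xy).
  rewrite /r (eq_choose eRxy); apply: choose_id; last exact: Rxx.
  by rewrite /= Rsym.
pose wt := [ffun x => if R ord0 x then None
                      else [pick a : 'Z_d | `[< prop_on U a (r x) x >]]].
have wt_some x a : wt x = Some a -> ~~ R ord0 x /\ prop_on U a (r x) x.
  by rewrite ffunE; case: ifP => // _; case: pickP => // b /asboolP rb [<-].
pose P := (equivalence_partition R setT, wt).
have P_wp : is_wpartition P.
  apply/andP; split; first exact: equivalence_partitionP.
  apply/forallP => x; rewrite (pblock_equivalence_partition eqR') ?inE // ffunE.
  (* The search for an exponent cannot fail here, since [r x] and [x] are related. *)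
  case: ifP => // _; case: pickP => // no.
  by have := Rr x; rewrite Rsym => /asboolP[a /asboolP]; rewrite no.
have Pblock x y : (y \in pblock (equivalence_partition R setT) x) = R x y.
  by rewrite (pblock_equivalence_partition eqR') ?inE.
exists (WPartition P_wp); split=> //.
  move=> v vU; split=> [x /eqP | B x y a b BP xB yB px py].
    by rewrite weightP Pblock => /prop_rel0->.
  have xy : R x y by rewrite -Pblock (blocks_def BP xB).
  have [_ /(_ v vU) ->] := wt_some _ _ px.
  have [_ /(_ v vU) ->] := wt_some _ _ py.
  by rewrite (rE _ _ xy) mulrAC.
move=> x y a b w px py xy.
have Rxy : R x y by apply/asboolP; exists w.
have [nx xa] := wt_some _ _ px; have [_ yb] := wt_some _ _ py.
(* Were all of [U] zero at [x], then [x] would be related to [ord0]. *)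
have [v vU vr] : exists2 v, v \in U & coord0 v x != 0.
  apply: contrapT => no; case/negP: nx; apply/asboolP; exists 0 => v vU.
  rewrite coord00 mul0r; apply/eqP/negPn/negP => vx; apply: no.
  by exists v.
move: vr (xy v vU); rewrite xa // yb // -(rE _ _ Rxy).
rewrite mulf_eq0 (negPf (chi_neq0 a)) orbF -mulrA -chiD => vr.
by move/(mulfI vr)/chi_inj.
Qed.

(** On eigenvectors the coordinate at the image of [x] is [zeta^-1] times that at [x], so [g] lowers
    the weights of the partition of its eigenspace. This yields both balance and the converse
    inclusion. *)
Lemma Vspace_partition g :
  exists2 p, wbalanced p & forall v, v \in Vspace zeta g <-> solves p v.
Proof.
have [p [pE pV pw]] := prop_partition (Vspace zeta g).
have gprop x : prop_on (Vspace zeta g) (- 1) x (perm0 g x).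
  move=> v /mem_VspaceP/(_ x) <-.
  by rewrite -mulrA [zeta * _]mulrC -[- 1]add0r chiBMzeta chi0 mulr1.
have gp : lowers_weight p g.
  move=> x; have gx : perm0 g x \in pblock (blocks p) x.
    by rewrite pE; apply/asboolP; exists (- 1).
  split=> //; have BP := pblock_blocks p x.
  have := weight_None BP gx; rewrite -(weight_None BP (mem_pblock0 p x)).
  case px: (weight p x) => [a|]; case pg: (weight p (perm0 g x)) => [b|] //= _.
  by rewrite (pw _ _ _ _ _ px pg (gprop x)).
exists p; first exact: lowers_weight_balanced gp.
by move=> v; split; [exact: pV | exact: lowers_weight_solves].
Qed.


(** * Permutations cycling through the blocks of a balanced partition *)

Lemma next_nth_uniq (T : eqType) (x0 : T) (r : seq T) k :
  uniq r -> (k < size r)%N -> next r (nth x0 r k) = nth x0 r (k.+1 %% size r).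
Proof.
move=> Ur kr; rewrite next_nth mem_nth //; case: r => // z r in Ur kr *.
rewrite index_uniq //; have [lt_kr|le_rk] := ltnP k (size r).
  by rewrite modn_small //= (set_nth_default x0).
have -> : k = size r by apply/eqP; rewrite eqn_leq le_rk andbT.
by rewrite modnn /= nth_default.
Qed.

(* The elements of a balanced nonzero block in an order along which the weight
   decreases by 1 at each step, cyclically; empty on the zero block. *)
Definition cycle_seq p B : seq 'I_n.+1 :=
  mkseq (fun k => nth ord0 (enum (wclass p B (- k%:R))) (k %/ d))
        (#|wclass p B 0%R| * d).

Section Cycle.

Variables (p : wpartition n d) (B : {set 'I_n.+1}).
Hypotheses (bal : wbalanced p) (BP : B \in blocks p).

Let s := cycle_seq p B.

Lemma size_cycle_seq : size s = (#|wclass p B 0%R| * d)%N.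
Proof. exact: size_mkseq. Qed.

Lemma card_wclass a : #|wclass p B a| = #|wclass p B 0%R|.
Proof. exact: (wbalancedP _ bal). Qed.

Lemma nth_cycle_seq k : (k < size s)%N -> nth ord0 s k \in wclass p B (- k%:R).
Proof.
rewrite size_cycle_seq => ks; rewrite nth_mkseq // -mem_enum mem_nth //.
by rewrite -cardE card_wclass ltn_divLR ?(ltnW d_gt1).
Qed.

(** A position [k] is recovered from its entry: the weight gives [k] modulo [d], the rank within the
    weight class gives [k %/ d]. *)
Lemma uniq_cycle_seq : uniq s.
Proof.
apply/mkseq_uniqP => k l; rewrite !inE -size_cycle_seq => ks ls.
have := nth_cycle_seq ks; have := nth_cycle_seq ls; rewrite size_cycle_seq in ks ls.
rewrite !nth_mkseq // => + + e; rewrite -e !inE.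
move=> /andP[_ /eqP ->] /andP[_ /eqP/Some_inj/oppr_inj kl].
move: e; rewrite kl => /eqP; rewrite nth_uniq ?enum_uniq //; last 2 first.
- by rewrite -cardE card_wclass ltn_divLR ?(ltnW d_gt1).
- by rewrite -cardE card_wclass ltn_divLR ?(ltnW d_gt1).
move=> /eqP kld; rewrite (divn_eq k d) (divn_eq l d) kld.
by rewrite -!(val_Zp_nat d_gt1) kl.
Qed.

Lemma mem_cycle_seq x : (x \in s) = (x \in B) && (weight p x != None).
Proof.
apply/idP/andP => [/(nthP ord0)[k ks <-] | [xB]].
  by have := nth_cycle_seq ks; rewrite inE => /andP[-> /eqP ->].
case px: (weight p x) => [a|] // _.
have xa : x \in enum (wclass p B a) by rewrite mem_enum inE xB px eqxx.
set i := index x (enum (wclass p B a)).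
have ia : (i < #|wclass p B 0%R|)%N by rewrite -(card_wclass a) cardE index_mem.
have ad : ((- a : 'Z_d) < d)%N by rewrite -[X in (_ < X)%N](Zp_cast d_gt1) ltn_ord.
(* Weight [a] occurs at the positions congruent to [- a] modulo [d], once in each round of length
   [d]; rank [i] is met in round [i]. *)
pose k := (i * d + (- a)%R)%N.
have ks : (k < size s)%N.
  rewrite size_cycle_seq; apply: leq_trans (_ : (i.+1 * d <= _)%N).
    by rewrite /k mulSn addnC ltn_add2r.
  by rewrite leq_mul2r ia orbT.
apply/(nthP ord0); exists k => //.
rewrite size_cycle_seq in ks; rewrite nth_mkseq //.
have -> : - k%:R = a.
  by rewrite -(Zp_nat_mod d_gt1) modnMDl Zp_nat_mod // natr_Zp opprK.
by rewrite divnMDl ?(ltnW d_gt1) // (divn_small ad) addn0 nth_index.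
Qed.

Lemma weight_next_cycle_seq x :
  x \in B -> weight p (next s x) = omap (+%R^~ (- 1)) (weight p x).
Proof.
move=> xB; have [|xs] := boolP (x \in s); last first.
  rewrite next_nth (negPf xs); move: xs; rewrite mem_cycle_seq xB negbK.
  by move=> /eqP ->.
move=> /(nthP ord0)[k ks <-]; rewrite (next_nth_uniq _ uniq_cycle_seq ks).
have := nth_cycle_seq ks; rewrite inE => /andP[_ /eqP ->] /=.
have s_gt0 : (0 < size s)%N by apply: leq_trans ks.
have := nth_cycle_seq (ltn_pmod k.+1 s_gt0); rewrite inE => /andP[_ /eqP ->].
congr Some; rewrite -opprD natr1; congr (- _).
(* The return from the last position to the first also lowers the weight by 1, because the length is
   a multiple of [d]. *)
rewrite -[LHS](Zp_nat_mod d_gt1) modn_dvdm ?Zp_nat_mod //.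
by rewrite size_cycle_seq dvdn_mull.
Qed.

Lemma next_cycle_seq_block x : x \in B -> next s x \in B.
Proof.
move=> xB; have [xs|xs] := boolP (x \in s); last by rewrite next_nth (negPf xs).
by have := mem_next s x; rewrite xs mem_cycle_seq => /andP[].
Qed.

End Cycle.

(** Equal images force equal blocks, and there [prev] inverts [next]; [ord0] is unweighted, hence
    fixed. *)
Lemma cycle_perm_exists p : wbalanced p ->
  exists g, forall x, perm0 g x = next (cycle_seq p (pblock (blocks p) x)) x.
Proof.
move=> bal; pose f x := next (cycle_seq p (pblock (blocks p) x)) x.
have fB x : f x \in pblock (blocks p) x.
  exact: next_cycle_seq_block bal (pblock_blocks p x) _ (mem_pblock0 p x).
have f_inj : injective f.
  move=> x y fxy; have pxy : pblock (blocks p) x = pblock (blocks p) y.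
    rewrite -(blocks_def (pblock_blocks p x) (fB x)) fxy.
    by rewrite (blocks_def (pblock_blocks p y) (fB y)).
  move: fxy; rewrite /f pxy.
  exact: (can_inj (prev_next (uniq_cycle_seq bal (pblock_blocks p y)))).
have f0 : perm f_inj ord0 = ord0.
  rewrite permE /f next_nth mem_cycle_seq ?pblock_blocks //.
  by rewrite weight_ord0 andbF.
by have [g gE] := perm0_exists f0; exists g => x; rewrite gE permE.
Qed.

Lemma balanced_Vspace p : wbalanced p ->
  exists g, forall v, v \in Vspace zeta g <-> solves p v.
Proof.
move=> bal; have [g gE] := cycle_perm_exists bal.
exists g => v; split; last first.
  apply: lowers_weight_solves => x; rewrite gE.
  have [BP xB] := (pblock_blocks p x, mem_pblock0 p x).
  by split; [exact: next_cycle_seq_block | exact: weight_next_cycle_seq].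
move=> /mem_VspaceP vg; split=> [x px | B x y a b BP xB yB px py].
  (* An unweighted [x] is fixed, so its coordinate is unchanged by multiplication by [zeta]; as
     [zeta] is not 1, it vanishes. *)
  have gx : perm0 g x = x.
    by rewrite gE next_nth mem_cycle_seq ?pblock_blocks // px andbF.
  move: (vg x); rewrite gx => /eqP; rewrite -subr_eq0 -[X in _ - X]mulr1 -mulrBr.
  rewrite mulf_eq0 subr_eq0 => /orP[/eqP // | /eqP z1].
  by have /chi_inj/eqP : chi 1 = chi 0; rewrite ?oner_eq0 // /chi z1 !expr1n.
pose r := cycle_seq p B.
(* Each step along the cycle divides the coordinate by [zeta], so the first entry determines all
   others. *)
have vr k : (k < size r)%N -> coord0 v (nth ord0 r k) * chi k%:R = coord0 v (nth ord0 r 0).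
  elim: k => [|k IHk] kr; first by rewrite chi0 mulr1.
  rewrite -IHk 1?ltnW // -[in RHS]vg gE.
  have := nth_cycle_seq bal BP (ltnW kr); rewrite inE => /andP[kB _].
  rewrite (blocks_def BP kB) next_nth_uniq ?uniq_cycle_seq ?(ltnW kr) //.
  by rewrite modn_small // !chi_nat exprS mulrA.
have inr z c : z \in B -> weight p z = Some c ->
    coord0 v z * chi (- c) = coord0 v (nth ord0 r 0).
  move=> zB pz; have : z \in r by rewrite mem_cycle_seq // zB pz.
  case/(nthP ord0)=> k kr zk; have := nth_cycle_seq bal BP kr.
  rewrite zk inE pz => /andP[_ /eqP/Some_inj ->]; rewrite opprK -zk; exact: vr.
have := inr _ _ yB py; rewrite -(inr _ _ xB px) => e.
apply: (mulIf (chi_neq0 (- a - b))); rewrite -!mulrA -!chiD.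
by rewrite addrCA subrr addr0 addrA subrr add0r.
Qed.

End Correspondence.

(** * The isomorphism of posets and its equivariance *)

Theorem theorem9p5 (R : realType) (n d : nat) (zeta : R[i]%C)
    (d_gt1 : (1 < d)%N) (zeta_prim : (d.-primitive_root zeta)%R) :
  exists f : eigposet n zeta -> bdowling n d,
    [/\ bijective f,
        forall U W : eigposet n zeta, (f U <= f W)%O = (U <= W)%O
      & forall (U : eigposet n zeta) (s : {perm 'I_n}),
          f (eig_action n zeta U s) = bdowling_action n d (f U) s].
Proof.
have /boolp.choice[p pP] : forall U : eigposet n zeta, exists p : wpartition n d,
    wbalanced p /\ forall v, v \in eig_val U <-> solves zeta p v.
  move=> U; rewrite -(eig_permK U).
  by have [p bal pE] := Vspace_partition d_gt1 zeta_prim (eig_perm U); exists p.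
have p_bal U : balanced (\pi_(dowling n d)%qT (p U)) by rewrite balancedE (pP U).1.
pose f U := BDowling (p_bal U).
have f_le U W : (f U <= f W)%O = (U <= W)%O.
  rewrite -Order.le_val dowling_leE.
  apply/idP/subvP => [le_pq v /(pP W).2 vW | sub].
    by apply/(pP U).2; apply: wle_solves le_pq vW.
  apply: (solves_wle d_gt1 zeta_prim) => v /(pP W).2/sub.
  by move/(pP U).2.
(* The solution space determines the class in the Dowling lattice; surjectivity and equivariance
   both rest on this. *)
have f_eq U (q : wpartition n d) : (forall v, v \in eig_val U <-> solves zeta q v) ->
    bd_val (f U) = \pi_(dowling n d)%qT q.
  move=> qE; apply/eqmodP; rewrite /= /wequiv_equiv /= wequivE.
  apply/andP; split; apply: (solves_wle d_gt1 zeta_prim) => v vS.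
    by apply/(pP U).2/qE.
  by apply/qE/(pP U).2.
exists f; split=> //.
  have f_inj : injective f.
    by move=> U W e; apply: le_anti; rewrite -!f_le e lexx.
  have /boolp.choice[h hK] : forall z, exists U, f U = z.
    move=> z; have bal : wbalanced (generic_quotient.repr (bd_val z)) := bd_valP z.
    have [g gE] := balanced_Vspace d_gt1 zeta_prim bal.
    exists (eig zeta g); apply: val_inj.
    exact: etrans (f_eq (eig zeta g) _ gE) (generic_quotient.reprK _).
  by exists h => // U; apply: f_inj; rewrite hK.
move=> U s; apply: val_inj; rewrite [val (bdowling_action _ _ _ _)]dowling_actE.
apply: f_eq => v; rewrite [eig_val _]eig_act_val.
split=> [/memv_imgP[u uU ->] | vs].
  by rewrite lfunE /=; apply/solves_wact/(pP U).2.
apply/memv_imgP; exists (perm_vect s^-1%g v).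
  by apply/(pP U).2/(solves_wact _ _ s); rewrite -perm_vectM mulVg perm_vect1.
by rewrite lfunE /= -perm_vectM mulVg perm_vect1.
Qed.
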